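(* Let $r,s,t$ be positive integers with $1\le t\le r-1$, and let $0<p<1$. There exists $N_-(r,s,t,p)$ such that for all $n\ge N_-(r,s,t,p)$, if $\mathcal{H}\subseteq\binom{[n]}{r}$ satisfies $\nu(\mathcal{H})\le s$, then $$\left\|\mathcal{H}\right\|_{t,p}\le \left\|\mathcal{H}_{n,r,s}\right\|_{t,p}.$$ Moreover, equality holds if and only if $\mathcal{H}$ is isomorphic to $\mathcal{H}_{n,r,s}$.
   Context: $[n]=\{1,\dots,n\}$ and $\binom{[n]}{r}$ is the collection of all $r$-subsets of $[n]$; an $r$-graph is a family $\mathcal{H}\subseteq\binom{[n]}{r}$, whose members are called edges. For $T\subseteq[n]$, $d_{\mathcal{H}}(T)=|\{H\in\mathcal{H}:T\subseteq H\}|$, and $\|\mathcal{H}\|_{t,p}=\sum_{T\in\binom{[n]}{t}}d_{\mathcal{H}}(T)^p$ (with $0^p=0$). The matching number $\nu(\mathcal{H})$ is the maximum number of pairwise disjoint edges of $\mathcal{H}$. The family $\mathcal{H}_{n,r,s}$ is $\{H\in\binom{[n]}{r}:H\cap[s]\neq\emptyset\}$. Two families on $[n]$ are isomorphic if a permutation of $[n]$ maps one onto the other. *)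

(* Defs.v *)
From mathcomp Require Import reals exp.
From mathcomp Require Import all_boot all_order all_fingroup all_algebra.

Set Implicit Arguments.
Unset Strict Implicit.
Unset Printing Implicit Defensive.

Import GRing.Theory Num.Theory.
Local Open Scope ring_scope.

(* The ground set [n] = {1, ..., n} is 'I_n, with k in [n] represented by the
   ordinal of value k - 1; a family of subsets of [n] is a {set {set 'I_n}}. *)

Definition rsubsets (n r : nat) : {set {set 'I_n}} :=
  [set A : {set 'I_n} | #|A| == r].

Definition degree (n : nat) (H : {set {set 'I_n}}) (T : {set 'I_n}) : nat :=
  #|[set A in H | T \subset A]|.

(* For p != 0, powR 0 p = 0. *)
Definition tpnorm (R : realType) (n t : nat) (p : R) (H : {set {set 'I_n}}) : R :=
  \sum_(T in rsubsets n t) powR (degree H T)%:R p.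

Definition matching_number (n : nat) (H : {set {set 'I_n}}) : nat :=
  \max_(M : {set {set 'I_n}} | (M \subset H) && trivIset M) #|M|.

(* [s] = {1, ..., s} is the set of ordinals of value < s. *)
Definition Hnrs (n r s : nat) : {set {set 'I_n}} :=
  [set A in rsubsets n r | A :&: [set i : 'I_n | (i < s)%N] != set0].

Definition isomorphic (n : nat) (F G : {set {set 'I_n}}) : Prop :=
  exists sigma : {perm 'I_n}, [set sigma @: A | A : {set 'I_n} in F] = G.

(* Main.v *)
Require Import Defs.
From mathcomp Require Import reals exp.
From mathcomp Require Import all_boot all_order all_fingroup all_algebra.
From mathcomp Require Import zify lra.

(** Write $d(T)$ for the degree of a t-set $T$, and put $k = r - t - 1$.  In
    the family of all r-sets meeting a fixed s-set, a t-set off that s-set has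
    degree about $s n^k / k!$, and a t-set meeting it has degree of order
    $n^{k+1}$.  There are order $n^t$ sets of the first kind and order
    $n^{t-1}$ of the second, so their contributions to the norm have orders
    $n^{t + kp}$ and $n^{t - 1 + (k+1)p}$.  As $p < 1$, the first kind
    dominates.  This is what makes the comparison soft: any $O(n^{t-1})$
    t-sets may be given up, with only the trivial bound $n^{k+1}$ on their
    degrees ([typical_beats_exceptional]).

    Let [H] have matching number at most $s$ and let $S$ be the set of
    vertices of degree larger than $r s n^{r-2}$.  At most $n^{r-2}$ edges
    through a vertex contain a second given vertex, so a matching that avoids
    $S$ can be extended greedily by one edge through each vertex of $S$; hence
    $|S| \le s$, and an edge avoiding $S$ meets a bounded set of vertices of
    small degree ([heavy_structure]).

    If $|S| = s$, no edge avoids $S$, so [H] lies inside the family of all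
    r-sets meeting $S$, which is isomorphic to the extremal one.  The norm is
    strictly monotone for inclusion and invariant under isomorphism, which
    gives both the inequality and the equality case.

    If $|S| < s$, only $O(n^{r-2})$ edges avoid $S$, so by averaging all but
    $O(n^{t-1})$ t-sets $T$ lie in few of them and avoid $S$.  For such $T$,
    $d(T)$ is at most about $(s - 1) n^k / k!$, which leaves room for
    an error of half of $n^k / k!$ below the degree $s n^k / k!$ of the
    extremal family.  The inequality is then strict for large $n$
    ([few_heavy_lt]). *)

Set Implicit Arguments.
Unset Strict Implicit.
Unset Printing Implicit Defensive.

(** * Orders of magnitude of binomial coefficients *)

Lemma leq_exp_base a b k : a <= b -> a ^ k <= b ^ k.
Proof. by case: k => // k ab; rewrite leq_exp2r. Qed.

Lemma bin_le_exp m k : 'C(m, k) <= m ^ k.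
Proof.
elim: m k => [|m IH] [|k]; rewrite ?bin0 ?expn0 ?bin0n //=.
rewrite binS (leq_trans (leq_add (IH _) (IH _))) // !expnS mulSn addnC.
rewrite leq_add ?leq_mul //.
all: exact: leq_exp_base.
Qed.

(** Pascal's rule, applied [a] times, changes a binomial coefficient of order
    $n^k$ by only $O(n^{k-1})$.  Multiplying through by the upper argument
    keeps the exponent $k$ and so covers $k = 0$ without a truncated
    $k - 1$. *)
Lemma bin_addl_le m a k :
  (m + a) * 'C(m + a, k) <= (m + a) * 'C(m, k) + a * k * (m + a) ^ k.
Proof.
case: k => [|k]; first by rewrite !bin0; lia.
rewrite expnS mulnCA -mulnDr leq_mul2l; apply/orP; right.
suff: forall b, b <= a ->
  'C(m + b, k.+1) <= 'C(m, k.+1) + b * k.+1 * (m + a) ^ k by exact.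
elim=> [|b IH] ba; first by rewrite addn0; lia.
rewrite addnS binS; have {}IH := IH (ltnW ba).
have h : 'C(m + b, k) <= (m + a) ^ k.
  by rewrite (leq_trans (bin_le_exp _ _)) ?leq_exp_base; lia.
nia.
Qed.

(** Each factor of the falling factorial of [m] is at least half of [n]. *)
Lemma exp_le_bin m n k : n <= 2 * (m - k).+1 -> k <= m ->
  n ^ k <= 2 ^ k * k`! * 'C(m, k).
Proof.
move=> nm km; rewrite -mulnA (mulnC k`!) bin_ffact.
have h : (m - k).+1 ^ k <= m ^_ k.
  elim: k m km {nm} => [|k IH] [|m] //= km; rewrite expnS ffactSS subSS leq_mul //; first by lia.
  exact: IH.
by rewrite (leq_trans _ (leq_mul (leqnn _) h)) // -expnMn leq_exp_base.
Qed.

(** Replacing the upper argument $n - t - 1$ by $n - t - s$ costs, for large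
    $n$, a fraction of the coefficient so small that the loss, repeated
    $s - 1$ times, stays below a quarter of one coefficient.  The long lower
    bound on $n$ is what [bin_addl_le] and [exp_le_bin] give. *)
Lemma bin_ratio n r s t (k := r - t - 1) : 0 < t < r -> 0 < s ->
  2 * (r + s) + 4 * s * s * k * (2 ^ k * k`!) + t + 1 <= n ->
  4 * (s - 1) * 'C(n - t - 1, k) <= (4 * (s - 1) + 1) * 'C(n - s - t, k).
Proof.
move=> /andP[t0 tr] s0; set c := 2 ^ k * k`! => nN.
have kr : k < r by rewrite /k; lia.
have := bin_addl_le (n - s - t) (s - 1) k.
have -> : n - s - t + (s - 1) = n - t - 1 by lia.
set D := 'C(n - s - t, k); set C := 'C(_, k); set q := n - t - 1.
have qk : q ^ k <= c * D.
  apply: leq_trans (leq_exp_base k (_ : q <= n)) (exp_le_bin _ _);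
    by rewrite /q; lia.
have qs : 4 * s * s * k * c <= q by rewrite /q; lia.
have q0 : 0 < q by rewrite /q; lia.
move=> h; rewrite -(leq_pmul2l q0).
have h2 : (s - 1) * k * q ^ k <= (s - 1) * k * (c * D) by rewrite leq_mul2l qk orbT.
have h3 : 4 * (s - 1) * ((s - 1) * k * (c * D)) <= q * D.
  apply: leq_trans (_ : 4 * s * s * k * c * D <= _); last by rewrite leq_mul2r qs orbT.
  have -> : 4 * (s - 1) * ((s - 1) * k * (c * D))
    = 4 * ((s - 1) * (s - 1)) * (k * c * D) by lia.
  have -> : 4 * s * s * k * c * D = 4 * (s * s) * (k * c * D) by lia.
  by rewrite leq_mul2r leq_mul2l leq_mul ?leq_subr ?orbT.
have h4 : 4 * (s - 1) * (q * C) <= 4 * (s - 1) * (q * D + (s - 1) * k * (c * D)).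
  by rewrite leq_mul2l (leq_trans h) ?orbT // leq_add2l.
by move: h4 h3; clear; lia.
Qed.

(** * Counting r-sets above and across given sets *)

Section Count.
Variables (n : nat).
Implicit Types (A T U W X S : {set 'I_n}) (H M : {set {set 'I_n}}).

Lemma card_between r U W : U \subset W -> #|U| <= r ->
  #|[set A in rsubsets n r | (U \subset A) && (A \subset W)]|
    = 'C(#|W| - #|U|, r - #|U|).
Proof.
move=> UW Ur.
have <- : #|W :\: U| = #|W| - #|U| by rewrite cardsD (setIidPr UW).
rewrite -cards_draws.
set F := [set A in rsubsets n r | _].
rewrite -[#|F|](@card_in_imset _ _ (fun A => A :\: U)); last first.
  move=> A B; rewrite !inE => /and3P[_ /setIidPr UA _] /and3P[_ /setIidPr UB _] e.
  by rewrite -(setID A U) -(setID B U) UA UB e.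
congr #|pred_of_set _|; apply/setP=> B; apply/imsetP/idP.
  case=> A; rewrite !inE => /and3P[/eqP cA UA AW] ->.
  by rewrite setSD // cardsD (setIidPr UA) cA /=.
rewrite inE subsetD => /andP[/andP[BW dBU] /eqP cB].
exists (U :|: B); last first.
  by rewrite setDUl setDv set0U; apply/esym/setDidPl.
rewrite !inE subsetUl subUset UW BW !andbT cardsU.
have -> : U :&: B = set0 by apply/eqP; rewrite setI_eq0 disjoint_sym.
by rewrite cards0 cB; lia.
Qed.

Lemma card_above r U : #|U| <= r ->
  #|[set A in rsubsets n r | U \subset A]| = 'C(n - #|U|, r - #|U|).
Proof.
move=> Ur; have := card_between (subsetT U) Ur; rewrite cardsT card_ord => <-.
by apply: eq_card => A; rewrite !inE subsetT andbT.
Qed.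

Lemma sum_card_exchange (I J : finType) (P : {set I}) (F : {set J})
    (e : I -> J -> bool) :
  \sum_(i in P) #|[set j in F | e i j]| = \sum_(j in F) #|[set i in P | e i j]|.
Proof.
under eq_bigr => i _ do rewrite -sum1_card.
under [RHS]eq_bigr => i _ do rewrite -sum1_card.
rewrite (eq_bigr (fun i => \sum_(j in F | e i j) 1)); last first.
  by move=> i _; apply: eq_bigl => j; rewrite !inE.
rewrite [RHS](eq_bigr (fun j => \sum_(i in P | e i j) 1)); last first.
  by move=> i _; apply: eq_bigl => j; rewrite !inE.
under eq_bigr => i _ do rewrite big_mkcondr.
under [RHS]eq_bigr => i _ do rewrite big_mkcondr.
exact: exchange_big.
Qed.

(** Union bound over the vertex of [X] contained in [A]. *)
Lemma card_above_meet_le r U X : #|U| < r -> [disjoint U & X] ->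
  #|[set A in rsubsets n r | (U \subset A) && (A :&: X != set0)]|
    <= #|X| * 'C(n - #|U| - 1, r - #|U| - 1).
Proof.
move=> Ur dUX.
set F := [set A in _ | _].
have -> : #|X| * 'C(n - #|U| - 1, r - #|U| - 1)
   = \sum_(x in X) #|[set A in rsubsets n r | x |: U \subset A]|.
  rewrite -sum_nat_const; apply: eq_bigr => x xX.
  have xU : x \notin U by apply: contraTN xX => xU; rewrite (disjointFr dUX xU).
  by rewrite card_above cardsU1 xU // add1n; congr 'C(_, _); lia.
rewrite sum_card_exchange (big_setID F) /= (leq_trans _ (leq_addr _ _)) //.
have -> : rsubsets n r :&: F = F by apply/setIidPr/subsetP=> A; rewrite !inE => /andP[].
rewrite -sum1_card leq_sum // => A; rewrite !inE => /and3P[_ UA /set0Pn[x]].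
rewrite inE => /andP[xA xX]; rewrite card_gt0; apply/set0Pn; exists x.
by rewrite inE xX subUset sub1set xA.
Qed.

(** For distinct [x] in [X], the r-sets that contain [U] and meet [X] exactly
    in [x] form disjoint classes, all of the same size. *)
Lemma card_above_meet_ge r U X : #|U| < r -> [disjoint U & X] ->
  #|X| * 'C(n - #|X| - #|U|, r - #|U| - 1) <=
  #|[set A in rsubsets n r | (U \subset A) && (A :&: X != set0)]|.
Proof.
move=> Ur dUX.
set F := [set A in _ | _].
have -> : #|X| * 'C(n - #|X| - #|U|, r - #|U| - 1)
   = \sum_(x in X) #|[set A in rsubsets n r |
         (x |: U \subset A) && (A \subset x |: ~: X)]|.
  rewrite -sum_nat_const; apply: eq_bigr => x xX.
  have xU : x \notin U by apply: contraTN xX => xU; rewrite (disjointFr dUX xU).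
  have cU : #|x |: U| = #|U|.+1 by rewrite cardsU1 xU.
  have cX : #|x |: ~: X| = (n - #|X|).+1.
    by rewrite cardsU1 !inE xX /= cardsCs setCK card_ord.
  rewrite card_between ?cU ?cX //; first by congr 'C(_, _); lia.
  by rewrite setUS // -disjoints_subset.
rewrite sum_card_exchange (big_setID F) /= [X in _ + X]big1 ?addn0; last first.
  move=> A; rewrite !inE => /andP[h /eqP cA]; apply/eqP; rewrite cards_eq0.
  apply: contraNT h => /set0Pn[x]; rewrite inE => /and3P[xX].
  rewrite subUset sub1set => /andP[xA UA] _.
  by rewrite cA eqxx UA; apply/set0Pn; exists x; rewrite inE xA.
have -> : rsubsets n r :&: F = F by apply/setIidPr/subsetP=> A; rewrite !inE => /andP[].
rewrite -sum1_card leq_sum // => A _.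
apply/card_le1_eqP => x y; rewrite !inE => /and3P[xX h1 h2] /and3P[yX h3 h4].
apply/eqP; move: h1; rewrite subUset sub1set => /andP[xA _].
by have := subsetP h4 x xA; rewrite !inE xX /= orbF eq_sym.
Qed.

Lemma sum_degree r t H : H \subset rsubsets n r ->
  \sum_(T in rsubsets n t) degree H T = #|H| * 'C(r, t).
Proof.
move=> Hr; rewrite [LHS](sum_card_exchange _ _ (fun T A => T \subset A)).
rewrite -sum_nat_const; apply: eq_bigr => A /(subsetP Hr); rewrite inE => /eqP cA.
rewrite -cA -cards_draws; apply: eq_card => T.
by rewrite !inE andbC.
Qed.

Lemma degree_le r H T : H \subset rsubsets n r -> degree H T <= n ^ (r - #|T|).
Proof.
move=> Hr; have [Tr|rT] := leqP #|T| r; last first.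
  rewrite [degree _ _](_ : _ = 0) //; apply/eqP; rewrite cards_eq0; apply/eqP/setP=> A.
  rewrite !inE; apply/negP=> /andP[/(subsetP Hr)]; rewrite inE => /eqP cA /subset_leq_card.
  by rewrite cA leqNgt rT.
have : degree H T <= 'C(n - #|T|, r - #|T|).
  rewrite -card_above // subset_leq_card //; apply/subsetP=> A.
  by rewrite !inE => /andP[/(subsetP Hr)]; rewrite inE => -> ->.
move=> h; apply: leq_trans h _; apply: leq_trans (bin_le_exp _ _) _.
by rewrite leq_exp_base ?leq_subr.
Qed.

Lemma matching_size M H : M \subset H -> trivIset M -> #|M| <= matching_number H.
Proof.
move=> MH tM; rewrite /matching_number.
exact: (@leq_bigmax_cond _ (fun M : {set {set 'I_n}} => (M \subset H) && trivIset M)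
   (fun M => #|M|) M (introT andP (conj MH tM))).
Qed.

Lemma card_cover_le r M : M \subset rsubsets n r -> #|cover M| <= #|M| * r.
Proof.
move=> Mr; apply: leq_trans (leq_card_cover M) _; rewrite -sum_nat_const leq_sum // => A.
by move=> /(subsetP Mr); rewrite inE => /eqP ->.
Qed.

(** Too many edges pass through [v] for all of them to meet [X], since a
    second prescribed vertex leaves at most $n^{r-2}$ edges. *)
Lemma edge_avoiding r H X v : H \subset rsubsets n r -> 1 < r -> v \notin X ->
  #|X| * n ^ (r - 2) < degree H [set v] ->
  exists2 A, A \in H & (v \in A) && [disjoint A & X].
Proof.
move=> Hr r1 vX hd.
have dvX : [disjoint [set v] & X] by rewrite disjoints1.
case: (boolP [exists A in H, (v \in A) && [disjoint A & X]]) => [/exists_inP//|].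
rewrite negb_exists_in => /forall_inP hA; move: hd; rewrite ltnNge.
have h : degree H [set v] <=
  #|[set A in rsubsets n r | ([set v] \subset A) && (A :&: X != set0)]|.
  rewrite subset_leq_card //; apply/subsetP=> A; rewrite inE sub1set => /andP[AH vA].
  have := subsetP Hr A AH; rewrite !inE sub1set vA => -> /=.
  by have := hA A AH; rewrite vA /= -setI_eq0.
case/negP; apply: leq_trans h _.
apply: leq_trans (card_above_meet_le _ dvX) _; rewrite cards1 //.
rewrite leq_mul2l -!subnDA; apply/orP; right; apply: leq_trans (bin_le_exp _ _) _.
by rewrite leq_exp_base ?leq_subr.
Qed.

(** A matching off [S] can be enlarged by one edge through each vertex of [S].
    At each step the new edge has to avoid the current matching and the rest
    of [S]; the induction hypothesis, applied to the matching before
    enlargement, bounds the number of those vertices by $rs$. *)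
Lemma matching_extends_to_heavy r H S M s :
  H \subset rsubsets n r -> 1 < r -> matching_number H <= s ->
  (forall v, v \in S -> r * s * n ^ (r - 2) < degree H [set v]) ->
  M \subset H -> trivIset M -> [disjoint cover M & S] -> #|M| + #|S| <= s.
Proof.
move=> Hr r1 nuH; move: {2}#|S| (erefl #|S|) => m.
elim: m S M => [|m IH] S M cS Sdeg MH tM dMS.
  by rewrite cS addn0 (leq_trans (matching_size MH tM)).
have /card_gt0P[v vS] : 0 < #|S| by rewrite cS.
have cS' : #|S :\ v| = m by have := cardsD1 v S; rewrite vS cS => -[].
have S'deg w : w \in S :\ v -> r * s * n ^ (r - 2) < degree H [set w].
  by rewrite inE => /andP[_ /Sdeg].
have dMS' : [disjoint cover M & S :\ v].
  by apply: disjointWr dMS; apply: subsetDl.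
have h1 := IH _ _ cS' S'deg MH tM dMS'.
have cX : #|cover M :|: S :\ v| <= r * s.
  rewrite cardsU (leq_trans (leq_subr _ _)) // cS'.
  have := card_cover_le (subset_trans MH Hr); rewrite cS' in h1; nia.
have vX : v \notin cover M :|: S :\ v.
  by rewrite !inE eqxx orbF; apply: contraTN vS => vM; rewrite (disjointFr dMS vM).
have [|A AH /andP[vA]] := edge_avoiding Hr r1 vX.
  by apply: leq_ltn_trans (Sdeg v vS); rewrite leq_mul2r cX orbT.
rewrite -setI_eq0 setIUr setU_eq0 !setI_eq0 => /andP[dAM dAS].
have [||tM' AM] := @trivIsetU1 _ A M _ tM.
- by move=> B BM; apply: disjointWr dAM; apply: bigcup_sup.
- apply/negP=> /(subsetP MH)/(subsetP Hr); rewrite inE cards0 => /eqP e.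
  by rewrite -e in r1.
have := IH _ (A |: M) cS' S'deg _ tM' _.
rewrite cardsU1 AM add1n cS' cS addSn addnS; apply.
  by rewrite subUset sub1set AH.
rewrite /cover big_setU1 //= -setI_eq0 setIUl setU_eq0 !setI_eq0 dAS.
exact: dMS'.
Qed.

End Count.

(** * Vertices of large degree *)

Section Structure.
Variables (n : nat).
Implicit Types (A T U W X S : {set 'I_n}) (H M : {set {set 'I_n}}).

Definition meeting r S : {set {set 'I_n}} :=
  [set A in rsubsets n r | A :&: S != set0].

Definition avoiding H S : {set {set 'I_n}} := [set A in H | [disjoint A & S]].

(** A new edge of a matching has to avoid at most $rs$ vertices, and each of
    them excludes at most $n^{r-2}$ edges through a given vertex. *)
Definition heavy r s H : {set 'I_n} :=
  [set v | r * s * n ^ (r - 2) < degree H [set v]].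

(** A maximal matching [M] among the edges that avoid the set $S$ of heavy
    vertices extends through $S$, so $|M| + |S| \le s$.  By maximality
    every edge avoiding $S$ meets one of the at most $rs$ vertices of [M], none
    of which is heavy.  When $|S| = s$ this [M] is empty, so no edge avoids
    $S$. *)
Lemma heavy_structure r s H : H \subset rsubsets n r -> 1 < r ->
  matching_number H <= s ->
  [/\ #|heavy r s H| <= s,
      #|avoiding H (heavy r s H)| <= (r * s) * (r * s * n ^ (r - 2)) &
      #|heavy r s H| = s -> H \subset meeting r (heavy r s H)].
Proof.
move=> Hr r1 nuH; set S := heavy r s H; set F := avoiding H S.
have FH : F \subset H by apply/subsetP=> A; rewrite inE => /andP[].
have [M /maxsetP[/andP[MF tM] maxM]] :
  {M | maxset (fun M : {set {set 'I_n}} => (M \subset F) && trivIset M) M}.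
  apply: ex_maxset; exists set0; rewrite sub0set.
  by apply/trivIsetP=> A B; rewrite inE.
have dMS : [disjoint cover M & S].
  rewrite disjoint_subset; apply/subsetP=> v /bigcupP[A AM vA].
  have := subsetP MF A AM; rewrite inE => /andP[_ dAS].
  by change (v \notin S); rewrite (disjointFr dAS vA).
have sM : #|M| + #|S| <= s.
  apply: (matching_extends_to_heavy Hr r1 nuH _ (subset_trans MF FH) tM dMS) => v.
  by rewrite inE.
have meetM A : A \in F -> ~~ [disjoint A & cover M].
  move=> AF; apply/negP=> dAM.
  have [||tM' AM] := @trivIsetU1 _ A M _ tM.
  - by move=> B BM; apply: disjointWr dAM; apply: bigcup_sup.
  - apply/negP=> /(subsetP MF)/(subsetP FH)/(subsetP Hr); rewrite inE cards0 => /eqP e.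
    by rewrite -e in r1.
  case/negP: AM; rewrite -(maxM (A |: M)) ?setU11 ?subsetUr //.
  by rewrite subUset sub1set AF MF.
split; first by rewrite (leq_trans _ sM) ?leq_addl.
- have cM : #|cover M| <= r * s.
    have := card_cover_le (subset_trans (subset_trans MF FH) Hr).
    by move: sM; clear; nia.
  apply: leq_trans (_ : #|cover M| * (r * s * n ^ (r - 2)) <= _); last by rewrite leq_mul2r cM orbT.
  rewrite -sum_nat_const.
  apply: leq_trans (_ : \sum_(v in cover M) degree H [set v] <= _); last first.
    apply: leq_sum => v vM; rewrite leqNgt; apply/negP=> hv.
    by have := disjointFr dMS vM; rewrite inE hv.
  rewrite [X in _ <= X](sum_card_exchange _ _ (fun (v : 'I_n) A => [set v] \subset A)).
  rewrite (big_setID F) /= (setIidPr FH) (leq_trans _ (leq_addr _ _)) //.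
  rewrite -sum1_card leq_sum // => A /meetM; rewrite -setI_eq0 => /set0Pn[v].
  rewrite inE => /andP[vA vM]; apply/card_gt0P; exists v.
  by rewrite inE sub1set vA vM.
- move=> cS; have M0 : M = set0.
    by apply/eqP; rewrite -cards_eq0 -leqn0 -(leq_add2r #|S|) add0n {2}cS.
  apply/subsetP=> A AH; rewrite inE (subsetP Hr A AH) /=; apply/negP=> AS.
  have : A \in F by rewrite inE AH -setI_eq0.
  by move/meetM; rewrite M0 -setI_eq0 /cover big_set0 setI0 eqxx.
Qed.

(** Edges through [T] either avoid [S] or are counted by
    [card_above_meet_le]. *)
Lemma degree_split r S H T : H \subset rsubsets n r -> #|T| < r -> [disjoint T & S] ->
  degree H T <= degree (avoiding H S) T + #|S| * 'C(n - #|T| - 1, r - #|T| - 1).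
Proof.
move=> Hr Tr dTS.
rewrite (leq_trans _ (leq_add (leqnn _) (card_above_meet_le Tr dTS))) //.
apply: leq_trans (leq_card_setU _ _); apply/subset_leq_card/subsetP=> A.
rewrite !inE => /andP[AH ->]; rewrite AH !andbT -setI_eq0 /=.
by case: eqP => //=; have := subsetP Hr A AH; rewrite inE => ->.
Qed.

(** The t-sets whose degrees are bounded only trivially: those that meet [S],
    and those whose degree in [F], the part of the hypergraph that avoids [S],
    exceeds a quarter of the typical size [D]. *)
Definition exceptional t D S (F : {set {set 'I_n}}) : {set {set 'I_n}} :=
  [set T in rsubsets n t | (T :&: S != set0) || (D < 4 * degree F T)].

(** Each exceptional t-set off [S] takes more than [D / 4] of the total degree
    of [F], which is $O(n^{r-2})$, while [D] has order $n^{r-t-1}$; the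
    quotient has order $n^{t-1}$.  The t-sets meeting [S] are as few. *)
Lemma card_exceptional_le r t S (F : {set {set 'I_n}}) c D C :
  F \subset rsubsets n r -> 0 < t < r -> 0 < n ->
  n ^ (r - t - 1) <= c * D -> #|F| <= C * n ^ (r - 2) ->
  n * #|exceptional t D S F| <= (#|S| + 4 * c * C * 'C(r, t)) * n ^ t.
Proof.
move=> Fr /andP[t0 tr] n0 nD cF.
set B1 := [set T in rsubsets n t | (set0 \subset T) && (T :&: S != set0)].
set B2 := [set T in rsubsets n t | D < 4 * degree F T].
have : #|exceptional t D S F| <= #|B1| + #|B2|.
  apply: leq_trans (leq_card_setU _ _); apply/subset_leq_card/subsetP=> T.
  by rewrite !inE sub0set /= => /andP[-> /orP[]->]; rewrite ?orbT.
have nt : n ^ t = n * n ^ (t - 1) by rewrite -expnS; congr (_ ^ _); lia.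
have b1 : #|B1| <= #|S| * n ^ (t - 1).
  have := @card_above_meet_le n t set0 S; rewrite cards0 !subn0 => h.
  have {}h : #|B1| <= #|S| * 'C(n - 1, t - 1) by apply: h; rewrite // -setI_eq0 set0I.
  apply: leq_trans h _; rewrite leq_mul2l; apply/orP; right.
  by rewrite (leq_trans (bin_le_exp _ _)) ?leq_exp_base ?leq_subr.
have b2 : #|B2| * D <= 4 * (C * n ^ (r - 2) * 'C(r, t)).
  apply: leq_trans (_ : 4 * (#|F| * 'C(r, t)) <= _); last by rewrite leq_mul2l leq_mul2r cF orbT.
  rewrite -(sum_degree t Fr) big_distrr /= -sum_nat_const [X in _ <= X](big_setID B2) /=.
  have -> : rsubsets n t :&: B2 = B2 by apply/setIidPr/subsetP=> A; rewrite inE => /andP[].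
  apply: leq_trans (leq_addr _ _); apply: leq_sum => T.
  by rewrite inE => /andP[_ /ltnW].
have nk : n * n ^ (r - 2) = n ^ t * n ^ (r - t - 1).
  by rewrite -expnS -expnD; congr (_ ^ _); lia.
have k0 : 0 < n ^ (r - t - 1) by rewrite expn_gt0 n0.
have b3 : n * #|B2| <= 4 * c * C * 'C(r, t) * n ^ t.
  rewrite -(leq_pmul2r k0).
  apply: leq_trans (_ : n * #|B2| * (c * D) <= _); first by rewrite leq_mul2l nD orbT.
  have -> : 4 * c * C * 'C(r, t) * n ^ t * n ^ (r - t - 1)
     = (n * c) * (4 * (C * n ^ (r - 2) * 'C(r, t))) by rewrite -!mulnA -nk; lia.
  have -> : n * #|B2| * (c * D) = (n * c) * (#|B2| * D) by lia.
  by rewrite leq_mul2l b2 orbT.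
rewrite nt in b3 *; nia.
Qed.

(** The three contributions, in units of [D], are at most $s - 1$ from the
    edges meeting [S], $1/4$ from the ratio of binomial coefficients, and $1/4$
    from the edges avoiding [S]; they add up to $s - 1/2$. *)
Lemma degree_typical_le r s t S H T D :
  H \subset rsubsets n r -> t < r -> #|S| < s ->
  4 * (s - 1) * 'C(n - t - 1, r - t - 1) <= (4 * (s - 1) + 1) * D ->
  T \in rsubsets n t :\: exceptional t D S (avoiding H S) ->
  2 * degree H T <= (2 * s - 1) * D.
Proof.
move=> Hr tr Ss CD; rewrite !inE => /andP[+ /eqP cT].
rewrite cT eqxx /= negb_or negbK -leqNgt setI_eq0 => /andP[dTS dD].
have := degree_split Hr _ dTS; rewrite cT => /(_ tr) h.
have {}h : 4 * degree H T <= D + 4 * (s - 1) * 'C(n - t - 1, r - t - 1) by nia.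
nia.
Qed.

Lemma degree_meeting_ge r S T : #|T| < r -> [disjoint T & S] ->
  #|S| * 'C(n - #|S| - #|T|, r - #|T| - 1) <= degree (meeting r S) T.
Proof.
move=> Tr dTS; apply: leq_trans (card_above_meet_ge Tr dTS) _.
by apply/subset_leq_card/subsetP=> A; rewrite !inE => /and3P[-> -> ->].
Qed.

End Structure.

Import Order.TTheory GRing.Theory Num.Theory.
Local Open Scope ring_scope.

(** * Isomorphism invariance and strict monotonicity of the norm *)

(** List each set followed by its complement, and send an element to the one
    at the same position in the other list. *)
Lemma perm_imset_exists (T : finType) (S L : {set T}) : #|S| = #|L| ->
  exists sigma : {perm T}, sigma @: S = L.
Proof.
move=> SL; pose list (X : {set T}) := enum X ++ enum (~: X).
have szl X : size (list X) = #|T| by rewrite size_cat -!cardE cardsC.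
have inl X x : x \in list X by rewrite mem_cat !mem_enum inE orbN.
have ul X : uniq (list X).
  rewrite cat_uniq !enum_uniq andbT /=; apply/hasPn=> x.
  by rewrite !mem_enum inE.
pose f x := nth x (list L) (index x (list S)).
have idx x : (index x (list S) < #|T|)%N by rewrite -(szl S) index_mem.
have f_inj : injective f.
  move=> x y; rewrite /f (set_nth_default y) ?szl // => /eqP.
  rewrite nth_uniq ?szl // => /eqP e.
  by rewrite -(nth_index x (inl S x)) e nth_index.
exists (perm f_inj); apply/eqP; rewrite eqEcard card_imset; last exact: perm_inj.
rewrite SL leqnn andbT; apply/subsetP=> _ /imsetP[x xS ->]; rewrite permE /f /list.
have lt : (index x (enum S) < #|L|)%N by rewrite -SL cardE index_mem mem_enum.
by rewrite index_cat mem_enum xS nth_cat -cardE lt -mem_enum mem_nth // -cardE.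
Qed.

Lemma powR_le (R : realType) (p x y : R) : 0 < p -> 0 <= x -> x <= y ->
  x `^ p <= y `^ p.
Proof.
move=> p0 x0 xy; have y0 := le_trans x0 xy.
by apply: ge0_ler_powR; rewrite ?nnegrE ?(ltW p0).
Qed.

Section Norm.
Variables (R : realType) (n : nat).
Implicit Types (A T S : {set 'I_n}) (H F G : {set {set 'I_n}}) (p : R).

Lemma degree_subset F G T : F \subset G -> (degree F T <= degree G T)%N.
Proof.
move=> FG; apply/subset_leq_card/subsetP=> A.
by rewrite !inE => /andP[/(subsetP FG)-> ->].
Qed.

Lemma degree_imset (sigma : {perm 'I_n}) H T :
  degree [set sigma @: A | A : {set 'I_n} in H] (sigma @: T) = degree H T.
Proof.
have inj : injective (fun A : {set 'I_n} => sigma @: A) by apply/imset_inj/perm_inj.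
rewrite /degree -[RHS](card_imset _ inj); apply: eq_card => B.
rewrite inE; apply/andP/imsetP.
  case=> /imsetP[A AH ->] TA; exists A => //; rewrite inE AH /=.
  apply/subsetP=> x xT; have := subsetP TA (sigma x) (imset_f _ xT).
  by rewrite mem_imset //; exact: perm_inj.
by case=> A; rewrite inE => /andP[AH TA] ->; split; [exact: imset_f | exact: imsetS].
Qed.

Lemma tpnorm_isomorphic t p F G : isomorphic F G -> tpnorm t p F = tpnorm t p G.
Proof.
case=> sigma <-; rewrite /tpnorm.
have inj : injective (fun A : {set 'I_n} => sigma @: A) by apply/imset_inj/perm_inj.
rewrite [RHS](reindex_inj inj) /=; apply: eq_big => T.
  by rewrite !inE card_imset //; exact: perm_inj.
by rewrite degree_imset.
Qed.

Lemma tpnorm_subset t p F G : 0 < p -> F \subset G -> tpnorm t p F <= tpnorm t p G.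
Proof.
move=> p0 FG; apply: ler_sum => T _.
by rewrite powR_le ?ler0n // ler_nat degree_subset.
Qed.

(** An edge of [G] missing from [F] contains a t-set, whose degree is then
    strictly smaller in [F]. *)
Lemma tpnorm_subset_eq r t p F G : 0 < p -> (t <= r)%N -> G \subset rsubsets n r ->
  F \subset G -> tpnorm t p F = tpnorm t p G -> F = G.
Proof.
move=> p0 tr Gr FG e; apply/eqP; rewrite eqEsubset FG /=; apply/subsetP=> A AG.
apply: contraPT e => AF.
have /eqP cA : #|A| == r by have := subsetP Gr A AG; rewrite inE.
have : (0 < #|[set T : {set 'I_n} | T \subset A & #|T| == t]|)%N.
  by rewrite cards_draws cA bin_gt0.
case/card_gt0P=> T; rewrite inE => /andP[TA /eqP cT].
apply/eqP; rewrite lt_eqF // /tpnorm.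
have Tt : T \in rsubsets n t by rewrite inE cT.
rewrite (bigD1 T) //= [X in _ < X](bigD1 T) //=; apply: ltr_leD.
  apply: gt0_ltr_powR; rewrite ?nnegrE ?ler0n // ltr_nat.
  apply: proper_card; apply/properP; split.
    by apply/subsetP=> B; rewrite !inE => /andP[/(subsetP FG)-> ->].
  by exists A; rewrite !inE ?AG ?TA // (negbTE AF).
by apply: ler_sum => U _; rewrite powR_le ?ler0n // ler_nat degree_subset.
Qed.

End Norm.

Lemma meeting_isomorphic n r (S L : {set 'I_n}) : #|S| = #|L| ->
  isomorphic (meeting r S) (meeting r L).
Proof.
case/perm_imset_exists=> sigma <-; exists sigma; apply/setP=> B.
have inj : injective sigma by apply: perm_inj.
have -> : B = sigma @: ((sigma^-1)%g @: B).
  by rewrite -imset_comp (eq_imset (g := id)) ?imset_id // => x; rewrite /= permKV.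
move: ((sigma^-1)%g @: B) => A {B}; rewrite mem_imset; last exact: imset_inj.
rewrite !inE card_imset // -imsetI ?imset_eq0 // => x y _ _; exact: inj.
Qed.

(** * Comparison for p < 1 *)

Section Analysis.
Variable R : realType.

(** The exponent $1 - p$ is positive, so $n^{1-p}$ passes $C / d$. *)
Lemma powR_sublinear (p C d : R) : 0 < p < 1 -> 0 <= C -> 0 < d ->
  exists N : nat, forall n : nat, (N <= n)%N -> C * n%:R `^ p < d * n%:R.
Proof.
move=> /andP[p0 p1] C0 d0; have q0 : 0 < 1 - p by lra.
have Cd : 0 <= C / d by rewrite divr_ge0 // ltW.
exists (Num.Def.archi_bound ((C / d) `^ (1 - p)^-1)).+1 => n nN.
have lt : (C / d) `^ (1 - p)^-1 < n%:R.
  apply: lt_le_trans (archi_boundP (powR_ge0 _ _)) _.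
  by rewrite ler_nat (leq_trans _ nN).
have n0 : 0 < n%:R :> R by apply: le_lt_trans lt; exact: powR_ge0.
have : C / d < n%:R `^ (1 - p).
  have := @gt0_ltr_powR _ _ q0 _ _ _ _ lt.
  rewrite -powRrM mulVf ?gt_eqF // powRr1 //; apply; rewrite ?nnegrE ?powR_ge0 ?ler0n //.
rewrite ltr_pdivrMr // => h.
have e : n%:R = n%:R `^ (1 - p) * n%:R `^ p :> R.
  rewrite -powRD; first by rewrite subrK powRr1 // ltW.
  by rewrite (gt_eqF n0) implybT.
rewrite [X in _ < _ * X]e mulrA ltr_pM2r ?powR_gt0 //; lra.
Qed.

(** Here [b] is the number of exceptional t-sets, each of degree at most
    $n^{k+1}$; [m] is the number of all t-sets, and [m'] of those off the
    s-set of the extremal family.  After multiplication by $n$ and division by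
    $m D^p$, the claim becomes
    $O(n^p) + (s - 1/2)^p n < s^p n - O(1)$. *)
Lemma typical_beats_exceptional (p : R) (s k t C c1 c2 : nat) :
  0 < p < 1 -> (0 < s)%N ->
  exists N : nat, forall n b m m' D : nat, (N <= n)%N ->
    (n * b <= C * n ^ t)%N -> (n * m <= n * m' + s * t * n ^ t)%N ->
    (n ^ t <= c1 * m)%N -> (n ^ k <= c2 * D)%N ->
  b%:R * ((n ^ k.+1)%N%:R `^ p) + m%:R * ((((2 * s - 1) * D)%N%:R / 2) `^ p)
   < m'%:R * (s * D)%N%:R `^ p.
Proof.
move=> p01 s0; have /andP[p0 p1] := p01.
set al : R := ((2 * s - 1)%N%:R / 2) `^ p; set be : R := s%:R `^ p.
have ab : al < be.
  apply: gt0_ltr_powR; rewrite ?nnegrE ?divr_ge0 ?ler0n //.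
  by rewrite natrB ?natrM; [lra | lia].
set g : R := c2%:R `^ p.
have g0 : 0 <= g by apply: powR_ge0.
have be0 : 0 <= be by apply: powR_ge0.
have K0 : 0 <= (C * c1)%N%:R * g + (s * t * c1)%N%:R * be.
  by rewrite addr_ge0 ?mulr_ge0 ?ler0n.
have [|N hN] := powR_sublinear p01 K0 (_ : 0 < be - al); first by rewrite subr_gt0.
exists N.+1 => n b m m' D nN hb hm hn hD.
have {}hN := hN n (ltnW nN).
have n0 : (0 < n)%N by lia.
have m0 : (0 < m)%N.
  by move: hn; case: (m) => //; rewrite muln0 leqn0 expn_eq0 => /andP[/eqP]; lia.
have D0 : (0 < D)%N.
  by move: hD; case: (D) => //; rewrite muln0 leqn0 expn_eq0 => /andP[/eqP]; lia.
have -> : (s * D)%N%:R `^ p = be * D%:R `^ p :> R by rewrite natrM powRM ?ler0n.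
have -> : (((2 * s - 1) * D)%N%:R / 2) `^ p = al * D%:R `^ p :> R.
  by rewrite natrM mulrAC powRM ?divr_ge0 ?ler0n.
have x0 : 0 < n%:R :> R by rewrite ltr0n.
have u0 : 0 < D%:R `^ p :> R by rewrite powR_gt0 // ltr0n.
rewrite expnS natrM powRM ?ler0n //.
(* The error terms of order 1 are absorbed into those of order [n `^ p]. *)
have q1 : 1 <= n%:R `^ p :> R.
  have := @ler_powR R n%:R _ 0 p (ltW p0); rewrite powRr0; apply.
  by rewrite ler1n.
have hk : (n ^ k)%N%:R `^ p <= g * D%:R `^ p :> R.
  by rewrite /g -powRM ?ler0n // -natrM powR_le ?ler0n // ler_nat.
move: hk q1 u0 hN; set q := n%:R `^ p; set u := D%:R `^ p; set v := (n ^ k)%N%:R `^ p.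
move=> hk q1 u0 hN; rewrite -(ltr_pM2l x0).
have mR0 : 0 < m%:R :> R by rewrite ltr0n.
have hb' : n%:R * b%:R <= (C * c1)%N%:R * m%:R :> R.
  rewrite -!natrM ler_nat; apply: leq_trans hb _.
  by rewrite -mulnA leq_mul2l hn orbT.
have hm' : n%:R * m%:R <= n%:R * m'%:R + (s * t * c1)%N%:R * m%:R :> R.
  rewrite -!natrM -natrD ler_nat; apply: leq_trans hm _.
  by rewrite leq_add2l -[in X in (_ <= X)%N]mulnA leq_mul2l hn orbT.
have q0 : 0 < q by lra.
have v0 : 0 <= v by apply: powR_ge0.
have e1 : n%:R * (b%:R * (q * v)) <= (C * c1)%N%:R * m%:R * (q * (g * u)).
  rewrite mulrA; apply: ler_pM => //; rewrite ?mulr_ge0 ?ler0n ?(ltW q0) //.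
  by rewrite ler_pM2l.
have e2 : (n%:R * m%:R - (s * t * c1)%N%:R * m%:R) * (be * u) <= n%:R * m'%:R * (be * u).
  by apply: ler_wpM2r; [rewrite mulr_ge0 // ltW | lra].
have e3 : (s * t * c1)%N%:R * be <= (s * t * c1)%N%:R * be * q.
  by rewrite ler_peMr // mulr_ge0 ?ler0n.
have e4 : (C * c1)%N%:R * g * q + (s * t * c1)%N%:R * be + al * n%:R < be * n%:R by lra.
have mu0 : 0 < m%:R * u by rewrite mulr_gt0.
have e5 := ltr_pM2l mu0; rewrite -e5 in e4.
rewrite mulrDr; lra.
Qed.

End Analysis.

Section Bounds.
Variables (R : realType) (n : nat).
Implicit Types (T S L : {set 'I_n}) (H B : {set {set 'I_n}}) (p y : R).

(** The t-sets in [B] get the trivial degree bound, all others the bound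
    [y]. *)
Lemma tpnorm_le_split r t p y H B : 0 < p -> H \subset rsubsets n r ->
  B \subset rsubsets n t -> 0 <= y ->
  (forall T, T \in rsubsets n t :\: B -> (degree H T)%:R <= y) ->
  tpnorm t p H <= #|B|%:R * (n ^ (r - t))%N%:R `^ p + 'C(n, t)%:R * y `^ p.
Proof.
move=> p0 Hr Bt y0 Hy; rewrite /tpnorm (big_setID B) /=; apply: lerD.
  rewrite (setIidPr Bt) mulr_natl -sumr_const; apply: ler_sum => T TB.
  rewrite powR_le ?ler0n // ler_nat.
  by have := degree_le T Hr; have := subsetP Bt T TB; rewrite inE => /eqP->.
apply: le_trans (_ : \sum_(T in rsubsets n t :\: B) y `^ p <= _).
  by apply: ler_sum => T TB; rewrite powR_le ?ler0n //; apply: Hy.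
rewrite sumr_const -[X in X <= _]mulr_natl ler_wpM2r ?powR_ge0 // ler_nat.
apply: leq_trans (subset_leq_card (subsetDl _ _)) _.
have := @card_above n t set0; rewrite cards0 !subn0 => <- //.
by apply/subset_leq_card/subsetP=> T TT; rewrite inE TT sub0set.
Qed.

(** Only the t-sets off [L] are kept; they carry the dominant term. *)
Lemma tpnorm_meeting_ge r t p L : 0 < p -> (t < r)%N ->
  'C(n - #|L|, t)%:R * (#|L| * 'C(n - #|L| - t, r - t - 1))%N%:R `^ p
   <= tpnorm t p (meeting r L).
Proof.
move=> p0 tr; set y := _ `^ p.
have <- : #|[set T in rsubsets n t | (set0 \subset T) && (T \subset ~: L)]|
   = 'C(n - #|L|, t).
  by rewrite card_between ?sub0set ?cards0 // !subn0 cardsCs setCK card_ord.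
set G := [set T in _ | _]; rewrite /tpnorm (big_setID G) /=.
have -> : rsubsets n t :&: G = G by apply/setIidPr/subsetP=> T; rewrite inE => /andP[].
rewrite -[X in X <= _]addr0; apply: lerD; last by apply: sumr_ge0 => T _; apply: powR_ge0.
rewrite mulr_natl -sumr_const; apply: ler_sum => T.
rewrite !inE sub0set /= -disjoints_subset => /andP[/eqP cT dTL].
rewrite powR_le ?ler0n // ler_nat.
have := @degree_meeting_ge n r L T; rewrite cT; exact.
Qed.

End Bounds.

(** * The extremal families *)

(** Let $D$ be the number of r-sets that contain a given t-set off [L] and
    meet [L] exactly in one given vertex.  With fewer than [s] heavy vertices,
    a typical t-set has degree at most $(s - 1/2) D$, against at least $s D$ in
    the extremal family. *)
Lemma few_heavy_lt (R : realType) (r s t : nat) (p : R) :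
  (0 < s)%N -> (0 < t < r)%N -> 0 < p < 1 ->
  exists N : nat, forall n (H : {set {set 'I_n}}) (L : {set 'I_n}), (N <= n)%N ->
    H \subset rsubsets n r -> (matching_number H <= s)%N -> #|L| = s ->
    (#|heavy r s H| < s)%N -> tpnorm t p H < tpnorm t p (meeting r L).
Proof.
move=> s0 t0r p01; have /andP[p0 _] := p01; have /andP[t0 tr] := t0r.
pose k := (r - t - 1)%N; pose c1 := (2 ^ t * t`!)%N; pose c2 := (2 ^ k * k`!)%N.
pose C := (s + 4 * c2 * (r * s * (r * s)) * 'C(r, t))%N.
have [N hN] := typical_beats_exceptional k t C c1 c2 p01 s0.
exists (N + (2 * (r + s) + 4 * s * s * k * c2 + t + 1))%N.
move=> n H L nN Hr nuH cL cS; set S := heavy r s H in cS *.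
set D := 'C(n - s - t, k); set F := avoiding H S; set B := exceptional t D S F.
have r1 : (1 < r)%N by lia.
have [_ cF _] := heavy_structure Hr r1 nuH; rewrite -/S -/F mulnA in cF.
have Fr : F \subset rsubsets n r.
  by apply: subset_trans Hr; apply/subsetP=> A; rewrite inE => /andP[].
have hk : (n ^ k <= c2 * D)%N by apply: exp_le_bin; rewrite /k; lia.
have hB : (n * #|B| <= C * n ^ t)%N.
  apply: leq_trans (card_exceptional_le _ Fr t0r _ hk cF) _; first lia.
  by rewrite leq_mul2r leq_add2r (ltnW cS) orbT.
have hbin : (4 * (s - 1) * 'C(n - t - 1, k) <= (4 * (s - 1) + 1) * D)%N.
  by apply: bin_ratio => //; rewrite -/k -/c2; lia.
have hm : (n * 'C(n, t) <= n * 'C(n - s, t) + s * t * n ^ t)%N.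
  by have := bin_addl_le (n - s) s t; rewrite subnK //; lia.
have ht : (n ^ t <= c1 * 'C(n, t))%N by apply: exp_le_bin; lia.
have := hN n _ _ _ D (leq_trans (leq_addr _ _) nN) hB hm ht hk.
have -> : k.+1 = (r - t)%N by rewrite /k; lia.
move=> lt; apply: le_lt_trans (lt_le_trans lt _); last first.
  by rewrite /D -cL; apply: tpnorm_meeting_ge.
apply: tpnorm_le_split => //.
- by apply/subsetP=> T; rewrite inE => /andP[].
- by rewrite divr_ge0 ?ler0n.
- move=> T TB; have := degree_typical_le Hr tr cS hbin TB.
  rewrite -(ler_nat R) natrM; lra.
Qed.

Theorem theorem1p2 (R : realType) (r s t : nat) (p : R)
    (hr : (0 < r)%N) (hs : (0 < s)%N) (ht : (1 <= t <= r - 1)%N)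
    (hp : 0 < p < 1) :
  exists N : nat, forall n : nat, (N <= n)%N ->
    forall H : {set {set 'I_n}}, H \subset rsubsets n r ->
      (matching_number H <= s)%N ->
      tpnorm t p H <= tpnorm t p (Hnrs n r s) /\
      (tpnorm t p H = tpnorm t p (Hnrs n r s) <-> isomorphic H (Hnrs n r s)).
Proof.
have t0r : (0 < t < r)%N by lia.
have [N hN] := few_heavy_lt hs t0r hp; have /andP[p0 _] := hp.
exists (N + s)%N => n nN H Hr nuH.
pose L : {set 'I_n} := [set i : 'I_n | (i < s)%N].
have cL : #|L| = s.
  have sn : (s <= n)%N by lia.
  have -> : L = [set widen_ord sn i | i in 'I_s].
    apply/setP=> i; rewrite inE; apply/idP/imsetP=> [is_|[j _ ->]] //=.
    by exists (Ordinal is_) => //; apply: val_inj.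
  by rewrite card_imset ?card_ord // => i j /(congr1 val) /= /val_inj.
have -> : Hnrs n r s = meeting r L by [].
suff [h1 h2] : tpnorm t p H <= tpnorm t p (meeting r L) /\
  (tpnorm t p H = tpnorm t p (meeting r L) -> isomorphic H (meeting r L)).
  by split=> //; split=> // /tpnorm_isomorphic.
have r1 : (1 < r)%N by lia.
have [cS _ HS] := heavy_structure Hr r1 nuH.
move: cS; rewrite leq_eqVlt => /orP[/eqP cS | cS]; last first.
  have lt : tpnorm t p H < tpnorm t p (meeting r L) by apply: hN => //; lia.
  by split; [exact: ltW | move=> e; rewrite e ltxx in lt].
have iso : isomorphic (meeting r (heavy r s H)) (meeting r L).
  by apply: meeting_isomorphic; rewrite cS cL.
rewrite -(tpnorm_isomorphic t p iso); split; first exact: tpnorm_subset (HS cS).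
have Sr : meeting r (heavy r s H) \subset rsubsets n r.
  by apply/subsetP=> A; rewrite inE => /andP[].
have tr : (t <= r)%N by lia.
by move=> e; rewrite {1}(tpnorm_subset_eq p0 tr Sr (HS cS) e).
Qed.
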